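(* For any set $X$, the semi-low $f_u$-ring $(2^X)^\sharp$ associated to the Boolean algebra $2^X$, regarded as a $PMV_f$-algebra, is isomorphic to the ring $B(\mathbb Z^X)$ of bounded functions of $\mathbb Z^X$ (i.e. bounded functions $X\to\mathbb Z$).
   Context: **MV-algebras.** An MV-algebra is $(A,\oplus,\neg,0)$ with $(A,\oplus,0)$ a commutative monoid, $\neg\neg x=x$, $x\oplus\neg 0=\neg 0$, $\neg(\neg x\oplus y)\oplus y=\neg(\neg y\oplus x)\oplus x$. Put $u=\neg 0$, $x\odot y=\neg(\neg x\oplus\neg y)$, $x\ominus y=\neg(\neg x\oplus y)$; the lattice order is $x\le y\iff x\ominus y=0$. An ideal is a nonempty down-closed subset closed under $\oplus$; an ideal $P$ is prime if $a\wedge b\in P$ implies $a\in P$ or $b\in P$; $Spec(A)$ is the set of prime ideals. For an ideal $I$, $A/I$ is the quotient by $x\equiv_I y\iff (x\ominus y)\oplus(y\ominus x)\in I$, with classes $[x]_I$. **$PMV_f$-algebras.** A $PMV_f$-algebra is an MV-algebra with an associative commutative product $\cdot$ such that for all $a,b,c$: $a0=0$; $a(b\oplus c)\le ab\oplus ac$; $ab\le a\wedge b$; $a(b\ominus c)=ab\ominus ac$. For a $PMV_f$-algebra $A$ and a prime ideal $P$ of its underlying MV-algebra, $A/P$ is a totally ordered $PMV_f$-algebra. A Boolean algebra is regarded as a $PMV_f$-algebra with $\oplus=\vee$, $\neg$ the complement, and product $ab=a\wedge b$; in particular this applies to $2^X$ with pointwise operations. **$l$-rings.** Rings are commutative and associative.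 An $l$-ring is a ring whose additive group is a lattice-ordered abelian group and in which $x,y\ge0$ implies $xy\ge0$. An $l_u$-ring is an $l$-ring with a distinguished strong unit $u\ge0$ (for each $x$ there is an integer $n\ge 0$ with $|x|\le nu$); it is semi-low if $ab\le a\wedge b$ for all $a,b\in[0,u]$. An $f$-ring is an $l$-ring in which $a\wedge b=0$ and $c\ge0$ imply $ac\wedge b=a\wedge cb=0$; an $f_u$-ring is an $l_u$-ring that is an $f$-ring. $B(\mathbb Z^X)$ is the ring of bounded functions $X\to\mathbb Z$ with pointwise addition and multiplication. **$A^\sharp$ for chains.** For a totally ordered $PMV_f$-algebra $A$, $A^\sharp$ is $\mathbb Z\times A$ with the identification $(m+1,0)=(m,u)$, addition $(m,a)+(n,b)=(m+n,a\oplus b)$ if $a\oplus b\ne u$ and $(m+n+1,a\odot b)$ if $a\oplus b=u$, negatives $-(m,a)=(-m-1,\neg a)$, lexicographic order (on representatives with second entry $\neq u$), strong unit $(0,u)=(1,0)$, and product $(m,a)(n,b)=mn(0,u^2)+m(0,bu)+n(0,au)+(0,ab)$. **$A^\sharp$ in general.** For a $PMV_f$-algebra $A$ and $a\in A$ let $(0,\widehat a)\in\prod_{P\in Spec(A)}(A/P)^\sharp$ be the element whose $P$-component is $(0,[a]_P)$. Then $A^\sharp$ is the sub-$l$-ring of this product generated by $\{(0,\widehat a):a\in A\}$, with strong unit $(0,\widehat u)$; it is a semi-low $f_u$-ring, called the one associated to $A$. *)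

(* Defs.v *)
From HB Require Import structures.
From Stdlib Require Import Relations.
From mathcomp Require Import all_boot all_order all_algebra.
From mathcomp Require Import generic_quotient.
From mathcomp Require Import boolp classical_sets.
From mathcomp Require Import zify.

Set Implicit Arguments.
Unset Strict Implicit.
Unset Printing Implicit Defensive.

Import Order.TTheory GRing.Theory Num.Theory.

Declare Scope mv_scope.
Delimit Scope mv_scope with mv.
Local Open Scope classical_set_scope.
Local Open Scope quotient_scope.
Local Open Scope mv_scope.

(** * MV-algebras *)

HB.mixin Record isMVAlgebra T of Choice T := {
  mv0 : T;
  mvneg : T -> T;
  mvadd : T -> T -> T;
  mvaddA : associative mvadd;
  mvaddC : commutative mvadd;
  mvaddx0 : right_id mv0 mvadd;
  mvnegK : involutive mvneg;
  mvadd_neg0 : forall x, mvadd x (mvneg mv0) = mvneg mv0;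
  mvaddN_swap : forall x y,
    mvadd (mvneg (mvadd (mvneg x) y)) y = mvadd (mvneg (mvadd (mvneg y) x)) x
}.

#[short(type="mvAlgebraType")]
HB.structure Definition MVAlgebra := { T of Choice T & isMVAlgebra T }.

Notation "¬ x" := (mvneg x) (at level 35, right associativity) : mv_scope.
Notation "x ⊕ y" := (mvadd x y) (at level 50, left associativity) : mv_scope.
Notation "0" := (mv0) : mv_scope.

Definition mvu {A : mvAlgebraType} : A := ¬ 0.
Definition mvmul {A : mvAlgebraType} (x y : A) : A := ¬ (¬ x ⊕ ¬ y).
Definition mvsub {A : mvAlgebraType} (x y : A) : A := ¬ (¬ x ⊕ y).

Notation "x ⊙ y" := (mvmul x y) (at level 40, left associativity) : mv_scope.
Notation "x ⊖ y" := (mvsub x y) (at level 50, left associativity) : mv_scope.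

Definition mvle {A : mvAlgebraType} (x y : A) : Prop := x ⊖ y = 0.

(* Join and meet for the order [mvle]: see [mvjoin_lub] and [mvmeet_glb]. *)
Definition mvjoin {A : mvAlgebraType} (x y : A) : A := (x ⊖ y) ⊕ y.
Definition mvmeet {A : mvAlgebraType} (x y : A) : A := ¬ mvjoin (¬ x) (¬ y).

Section MVTheory.
Context {A : mvAlgebraType}.
Implicit Types x y z t : A.

Lemma mvadd0x x : 0 ⊕ x = x.
Proof. by rewrite mvaddC mvaddx0. Qed.

Lemma mvaddxu x : x ⊕ mvu = mvu.
Proof. exact: mvadd_neg0. Qed.

Lemma mvaddux x : mvu ⊕ x = mvu.
Proof. by rewrite mvaddC mvaddxu. Qed.

Lemma mvnegu : ¬ mvu = 0 :> A.
Proof. by rewrite /mvu mvnegK. Qed.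

Lemma mvaddNx x : ¬ x ⊕ x = mvu.
Proof.
have := mvaddN_swap mvu x.
by rewrite mvaddxu mvnegu !mvadd0x.
Qed.

Lemma mvaddxN x : x ⊕ ¬ x = mvu.
Proof. by rewrite mvaddC mvaddNx. Qed.

Lemma mvleE x y : mvle x y <-> ¬ x ⊕ y = mvu.
Proof.
rewrite /mvle /mvsub /mvu; split=> [H | ->]; last by rewrite mvnegK.
by rewrite -[LHS]mvnegK H.
Qed.

Lemma mvle_refl x : mvle x x.
Proof. by apply/mvleE; rewrite mvaddNx. Qed.

Lemma mvsubDK x y : mvle x y -> y = (y ⊖ x) ⊕ x.
Proof. by rewrite /mvle /mvsub -mvaddN_swap => ->; rewrite mvadd0x. Qed.

Lemma mvle_addr x y : mvle x (x ⊕ y).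
Proof. by apply/mvleE; rewrite mvaddA mvaddNx mvaddux. Qed.

Lemma mvle_addl x y : mvle x (y ⊕ x).
Proof. by rewrite mvaddC; exact: mvle_addr. Qed.

Lemma mvle_trans y x z : mvle x y -> mvle y z -> mvle x z.
Proof.
move=> /mvsubDK -> /mvsubDK ->.
by rewrite mvaddA; exact: mvle_addl.
Qed.

Lemma mvle_anti x y : mvle x y -> mvle y x -> x = y.
Proof. by move=> /mvsubDK {2}-> yx; rewrite /mvsub -mvaddN_swap [RHS]mvaddN_swap
  -/(mvsub y x) yx mvadd0x. Qed.

Lemma mvle_add x y z t : mvle x y -> mvle z t -> mvle (x ⊕ z) (y ⊕ t).
Proof.
move=> /mvsubDK -> /mvsubDK ->; set a := y ⊖ x; set b := t ⊖ z.
have -> : a ⊕ x ⊕ (b ⊕ z) = (a ⊕ b) ⊕ (x ⊕ z).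
  by rewrite !mvaddA -(mvaddA a x b) (mvaddC x b) !mvaddA.
exact: mvle_addl.
Qed.

Lemma mvle_sub_add x y z : mvle (x ⊖ y) z <-> mvle x (y ⊕ z).
Proof. by rewrite !mvleE /mvsub mvnegK mvaddA. Qed.

Lemma mvle_subl x y : mvle (x ⊖ y) x.
Proof. by apply/mvle_sub_add; exact: mvle_addl. Qed.

Lemma mvle_subDK x y : mvle x (y ⊕ (x ⊖ y)).
Proof. by apply/mvle_sub_add; exact: mvle_refl. Qed.

Lemma mvsubxx x : x ⊖ x = 0.
Proof. exact: mvle_refl. Qed.

Lemma mvle_sub_trans x y z : mvle (x ⊖ z) ((x ⊖ y) ⊕ (y ⊖ z)).
Proof.
apply/mvle_sub_add; apply: (mvle_trans (mvle_subDK x y)).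
rewrite (mvaddC (x ⊖ y)) mvaddA.
by apply: mvle_add; [exact: mvle_subDK | exact: mvle_refl].
Qed.

Lemma mvsubNN x y : ¬ x ⊖ ¬ y = y ⊖ x.
Proof. by rewrite /mvsub mvnegK mvaddC. Qed.

Lemma mvle_subDD x y z t : mvle ((x ⊕ y) ⊖ (z ⊕ t)) ((x ⊖ z) ⊕ (y ⊖ t)).
Proof.
apply/mvle_sub_add.
have -> : z ⊕ t ⊕ (x ⊖ z ⊕ (y ⊖ t)) = (z ⊕ (x ⊖ z)) ⊕ (t ⊕ (y ⊖ t)).
  by rewrite !mvaddA -(mvaddA z t) (mvaddC t) !mvaddA.
by apply: mvle_add; exact: mvle_subDK.
Qed.

Lemma mvjoinC x y : mvjoin x y = mvjoin y x.
Proof. exact: mvaddN_swap. Qed.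

Lemma mvjoin_lub x y z : mvle (mvjoin x y) z <-> mvle x z /\ mvle y z.
Proof.
split=> [xyz | [xz yz]].
  split; apply: mvle_trans xyz; last exact: mvle_addl.
  by rewrite mvjoinC; exact: mvle_addl.
rewrite (mvsubDK yz) /mvjoin; apply: mvle_add; last exact: mvle_refl.
apply/mvle_sub_add; apply: (mvle_trans xz); exact: mvle_subDK.
Qed.

Lemma mvmeet_glb x y z : mvle z (mvmeet x y) <-> mvle z x /\ mvle z y.
Proof.
have N (a b : A) : mvle a b <-> mvle (¬ b) (¬ a) by rewrite /mvle mvsubNN.
by rewrite N /mvmeet mvnegK mvjoin_lub -!N.
Qed.

Lemma mvmeet_lel x y : mvle (mvmeet x y) x.
Proof. by case: (mvmeet_glb x y (mvmeet x y)) => + _ => /(_ (mvle_refl _)) []. Qed.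

End MVTheory.

(** * Product MV-algebras *)

HB.mixin Record isPMVf A of MVAlgebra A := {
  pmul : A -> A -> A;
  pmulA : associative pmul;
  pmulC : commutative pmul;
  pmulx0 : forall a, pmul a 0 = 0;
  pmulD_le : forall a b c, mvle (pmul a (b ⊕ c)) (pmul a b ⊕ pmul a c);
  pmul_le_meet : forall a b, mvle (pmul a b) (mvmeet a b);
  pmulB : forall a b c, pmul a (b ⊖ c) = pmul a b ⊖ pmul a c
}.

#[short(type="pmvfType")]
HB.structure Definition PMVf := { A of MVAlgebra A & isPMVf A }.

Notation "x · y" := (pmul x y) (at level 40, left associativity) : mv_scope.

(** * Ideals, prime ideals and quotients *)

Record ideal (A : mvAlgebraType) := Ideal {
  ideal_set :> A -> Prop;
  ideal_nonempty : exists a, ideal_set a;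
  ideal_down : forall a b, mvle a b -> ideal_set b -> ideal_set a;
  ideal_add : forall a b, ideal_set a -> ideal_set b -> ideal_set (a ⊕ b)
}.

(* The improper ideal [A] satisfies this condition too; its quotient is the
   one-element algebra. *)
Definition is_prime {A : mvAlgebraType} (P : ideal A) : Prop :=
  forall a b : A, P (mvmeet a b) -> P a \/ P b.

Definition Spec (A : mvAlgebraType) : Type := {P : ideal A | is_prime P}.

Section Quotient.
Context {A : mvAlgebraType} (I : ideal A).

Definition ideal_cong (x y : A) : bool := `[< I ((x ⊖ y) ⊕ (y ⊖ x)) >].

Lemma ideal_congP x y : reflect (I (x ⊖ y) /\ I (y ⊖ x)) (ideal_cong x y).
Proof.
apply: (iffP (asboolP _)) => [H | [H1 H2]]; last exact: ideal_add.
split; apply: ideal_down H; [exact: mvle_addr | exact: mvle_addl].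
Qed.

Lemma ideal0 : I 0.
Proof.
have [a aI] := ideal_nonempty I; apply: ideal_down aI.
by apply/mvleE; rewrite mvaddux.
Qed.

Lemma ideal_cong_refl : reflexive ideal_cong.
Proof. by move=> x; apply/ideal_congP; rewrite mvsubxx; split; exact: ideal0. Qed.

Lemma ideal_cong_sym : symmetric ideal_cong.
Proof. by move=> x y; rewrite /ideal_cong mvaddC. Qed.

Lemma ideal_cong_trans : transitive ideal_cong.
Proof.
move=> y x z /ideal_congP[xy yx] /ideal_congP[yz zy]; apply/ideal_congP.
by split; [apply: ideal_down (mvle_sub_trans x y z) _
          | apply: ideal_down (mvle_sub_trans z y x) _]; exact: ideal_add.
Qed.

Canonical ideal_equiv :=
  EquivRel ideal_cong ideal_cong_refl ideal_cong_sym ideal_cong_trans.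

Definition mvquot := {eq_quot ideal_equiv}.
HB.instance Definition _ := Choice.on mvquot.
HB.instance Definition _ := EqQuotient.on mvquot.

Definition mvclass (a : A) : mvquot := \pi_mvquot a.

Lemma mvclassP x y : mvclass x = mvclass y <-> I (x ⊖ y) /\ I (y ⊖ x).
Proof.
by split=> [/eqmodP/ideal_congP | /ideal_congP H] //; apply/eqmodP.
Qed.

Lemma mvclass_repr (x : mvquot) : x = mvclass (repr x).
Proof. by rewrite /mvclass reprK. Qed.

Lemma repr_mvclass a : I (repr (mvclass a) ⊖ a) /\ I (a ⊖ repr (mvclass a)).
Proof. by apply/mvclassP; rewrite -mvclass_repr. Qed.

Definition quot_neg (x : mvquot) : mvquot := mvclass (¬ repr x).
Definition quot_add (x y : mvquot) : mvquot := mvclass (repr x ⊕ repr y).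

Lemma quot_negE a : quot_neg (mvclass a) = mvclass (¬ a).
Proof. by apply/mvclassP; rewrite !mvsubNN; case: (repr_mvclass a). Qed.

Lemma quot_addE a b : quot_add (mvclass a) (mvclass b) = mvclass (a ⊕ b).
Proof.
have [a1 a2] := repr_mvclass a; have [b1 b2] := repr_mvclass b.
by apply/mvclassP; split; apply: ideal_down (mvle_subDD _ _ _ _) _;
  exact: ideal_add.
Qed.

Let quotE := (quot_negE, quot_addE).

Lemma quot_addA : associative quot_add.
Proof.
move=> x y z; rewrite (mvclass_repr x) (mvclass_repr y) (mvclass_repr z).
by rewrite !quotE mvaddA.
Qed.

Lemma quot_addC : commutative quot_add.
Proof.
by move=> x y; rewrite (mvclass_repr x) (mvclass_repr y) !quotE mvaddC.
Qed.

Lemma quot_addx0 : right_id (mvclass 0) quot_add.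
Proof. by move=> x; rewrite (mvclass_repr x) !quotE mvaddx0. Qed.

Lemma quot_negK : involutive quot_neg.
Proof. by move=> x; rewrite (mvclass_repr x) !quotE mvnegK. Qed.

Lemma quot_add_neg0 x :
  quot_add x (quot_neg (mvclass 0)) = quot_neg (mvclass 0).
Proof. by rewrite (mvclass_repr x) !quotE mvadd_neg0. Qed.

Lemma quot_addN_swap x y :
  quot_add (quot_neg (quot_add (quot_neg x) y)) y =
  quot_add (quot_neg (quot_add (quot_neg y) x)) x.
Proof.
by rewrite (mvclass_repr x) (mvclass_repr y) !quotE mvaddN_swap.
Qed.

HB.instance Definition _ := isMVAlgebra.Build mvquot
  quot_addA quot_addC quot_addx0 quot_negK quot_add_neg0 quot_addN_swap.

Lemma mvclassN a : ¬ mvclass a = mvclass (¬ a). Proof. exact: quot_negE. Qed.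
Lemma mvclassD a b : mvclass a ⊕ mvclass b = mvclass (a ⊕ b).
Proof. exact: quot_addE. Qed.
Lemma mvclassB a b : mvclass a ⊖ mvclass b = mvclass (a ⊖ b).
Proof. by rewrite /mvsub !(mvclassN, mvclassD). Qed.
Lemma mvclassI a b : mvmeet (mvclass a) (mvclass b) = mvclass (mvmeet a b).
Proof. by rewrite /mvmeet /mvjoin !(mvclassN, mvclassB, mvclassD). Qed.

Lemma mvclass_le a b : mvle a b -> mvle (mvclass a) (mvclass b).
Proof. by rewrite /mvle mvclassB => ->. Qed.

End Quotient.

Section PQuotient.
Context {A : pmvfType} (I : ideal A).

Definition quot_mul (x y : mvquot I) : mvquot I := mvclass I (repr x · repr y).

Lemma pmul_subr_le (a b c d : A) :
  mvle ((a · b) ⊖ (c · d)) ((a ⊖ c) ⊕ (b ⊖ d)).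
Proof.
have lel (x y : A) : mvle (x · y) x.
  exact: mvle_trans (pmul_le_meet x y) (mvmeet_lel x y).
apply: mvle_trans (mvle_sub_trans _ (c · b) _) _.
apply: mvle_add; last by rewrite -pmulB pmulC.
by rewrite (pmulC a) (pmulC c) -pmulB pmulC.
Qed.

Lemma quot_mulE a b :
  quot_mul (mvclass I a) (mvclass I b) = mvclass I (a · b).
Proof.
have [a1 a2] := repr_mvclass I a; have [b1 b2] := repr_mvclass I b.
by apply/mvclassP; split; apply: ideal_down (pmul_subr_le _ _ _ _) _;
  exact: ideal_add.
Qed.

Lemma quot_mulA : associative quot_mul.
Proof.
move=> x y z; rewrite (mvclass_repr x) (mvclass_repr y) (mvclass_repr z).
by rewrite !quot_mulE pmulA.
Qed.

Lemma quot_mulC : commutative quot_mul.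
Proof.
by move=> x y; rewrite (mvclass_repr x) (mvclass_repr y) !quot_mulE pmulC.
Qed.

Lemma quot_mulx0 x : quot_mul x 0 = 0.
Proof.
by rewrite (mvclass_repr x) -[RHS]/(mvclass I 0) quot_mulE pmulx0.
Qed.

Lemma quot_mulD_le x y z :
  mvle (quot_mul x (y ⊕ z)) (quot_mul x y ⊕ quot_mul x z).
Proof.
rewrite (mvclass_repr x) (mvclass_repr y) (mvclass_repr z).
by rewrite !(mvclassD, quot_mulE); apply: mvclass_le; exact: pmulD_le.
Qed.

Lemma quot_mul_le_meet x y : mvle (quot_mul x y) (mvmeet x y).
Proof.
rewrite (mvclass_repr x) (mvclass_repr y) quot_mulE mvclassI.
by apply: mvclass_le; exact: pmul_le_meet.
Qed.

Lemma quot_mulB x y z : quot_mul x (y ⊖ z) = quot_mul x y ⊖ quot_mul x z.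
Proof.
rewrite (mvclass_repr x) (mvclass_repr y) (mvclass_repr z).
by rewrite !(mvclassB, quot_mulE) pmulB.
Qed.

HB.instance Definition _ := isPMVf.Build (mvquot I)
  quot_mulA quot_mulC quot_mulx0 quot_mulD_le quot_mul_le_meet quot_mulB.

End PQuotient.

(** * The Boolean algebra [2^X] *)

Definition pow2 (X : Type) : Type := X -> bool.

Section Pow2.
Variable X : Type.
Implicit Types a b c : pow2 X.

HB.instance Definition _ := Choice.copy (pow2 X) (X -> bool).

Let add a b : pow2 X := fun x => a x || b x.
Let neg a : pow2 X := fun x => ~~ a x.
Let zero : pow2 X := fun=> false.
Let mul a b : pow2 X := fun x => a x && b x.

Let addA : associative add.
Proof. by move=> a b c; apply/funext => x; exact: orbA. Qed.
Let addC : commutative add.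
Proof. by move=> a b; apply/funext => x; exact: orbC. Qed.
Let addx0 : right_id zero add.
Proof. by move=> a; apply/funext => x; exact: orbF. Qed.
Let negK : involutive neg.
Proof. by move=> a; apply/funext => x; exact: negbK. Qed.
Let add_neg0 a : add a (neg zero) = neg zero.
Proof. by apply/funext => x; exact: orbT. Qed.
Let addN_swap a b :
  add (neg (add (neg a) b)) b = add (neg (add (neg b) a)) a.
Proof. by apply/funext => x; rewrite /add /neg; case: (a x); case: (b x). Qed.

HB.instance Definition _ := isMVAlgebra.Build (pow2 X)
  addA addC addx0 negK add_neg0 addN_swap.

Let mulA : associative mul.
Proof. by move=> a b c; apply/funext => x; exact: andbA. Qed.
Let mulC : commutative mul.
Proof. by move=> a b; apply/funext => x; exact: andbC. Qed.
Let mulx0 a : mul a 0 = 0.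
Proof. by apply/funext => x; exact: andbF. Qed.
Let mulD_le a b c : mvle (mul a (b ⊕ c)) (mul a b ⊕ mul a c).
Proof.
apply/funext => x; rewrite /mul /mvsub /mvneg /mvadd /= /neg /add.
by case: (a x); case: (b x); case: (c x).
Qed.
Let mul_le_meet a b : mvle (mul a b) (mvmeet a b).
Proof.
apply/funext => x.
rewrite /mul /mvmeet /mvjoin /mvsub /mvneg /mvadd /= /neg /add.
by case: (a x); case: (b x).
Qed.
Let mulB a b c : mul a (b ⊖ c) = mul a b ⊖ mul a c.
Proof.
apply/funext => x; rewrite /mul /mvsub /mvneg /mvadd /= /neg /add.
by case: (a x); case: (b x); case: (c x).
Qed.

HB.instance Definition _ := isPMVf.Build (pow2 X)
  mulA mulC mulx0 mulD_le mul_le_meet mulB.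

End Pow2.

(** * l-rings and their isomorphisms *)

Local Open Scope ring_scope.

(* The operations of an l-ring; the laws are [is_lring] below. Rings are not
   assumed to have a multiplicative identity. *)
Record lRingData := LRingData {
  lcarrier :> Type;
  lzero : lcarrier;
  ladd : lcarrier -> lcarrier -> lcarrier;
  lopp : lcarrier -> lcarrier;
  lmul : lcarrier -> lcarrier -> lcarrier;
  lle : lcarrier -> lcarrier -> Prop;
  lmeet : lcarrier -> lcarrier -> lcarrier;
  ljoin : lcarrier -> lcarrier -> lcarrier
}.
Arguments lzero {l}.

Record luRingData := LuRingData {
  lu_lring :> lRingData;
  lunit : lu_lring
}.
Arguments lunit {l}.

Record is_lring (S : lRingData) : Prop := IsLRing {
  laddA : associative (@ladd S);
  laddC : commutative (@ladd S);
  ladd0 : left_id lzero (@ladd S);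
  laddN : left_inverse lzero (@lopp S) (@ladd S);
  lmulA : associative (@lmul S);
  lmulC : commutative (@lmul S);
  lmulDl : left_distributive (@lmul S) (@ladd S);
  lle_refl : forall x : S, lle x x;
  lle_anti : forall x y : S, lle x y -> lle y x -> x = y;
  lle_trans : forall y x z : S, lle x y -> lle y z -> lle x z;
  lmeet_glb : forall x y z : S, lle z (lmeet x y) <-> lle z x /\ lle z y;
  ljoin_lub : forall x y z : S, lle (ljoin x y) z <-> lle x z /\ lle y z;
  lle_add : forall x y z : S, lle x y -> lle (ladd x z) (ladd y z);
  lmul_ge0 : forall x y : S,
    lle lzero x -> lle lzero y -> lle lzero (lmul x y)
}.

Definition labs (S : lRingData) (x : S) : S := ljoin x (lopp x).

Definition lnatmul (S : lRingData) (n : nat) (x : S) : S :=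
  iter n (ladd x) lzero.

Definition is_strong_unit (S : luRingData) : Prop :=
  lle lzero (lunit : S) /\
  forall x : S, exists n : nat, lle (labs x) (lnatmul n lunit).

Definition is_semi_low (S : luRingData) : Prop :=
  forall a b : S, lle lzero a -> lle a lunit -> lle lzero b -> lle b lunit ->
    lle (lmul a b) (lmeet a b).

Definition is_fring (S : lRingData) : Prop :=
  forall a b c : S, lmeet a b = lzero -> lle lzero c ->
    lmeet (lmul a c) b = lzero /\ lmeet a (lmul c b) = lzero.

Definition is_semi_low_fu_ring (S : luRingData) : Prop :=
  [/\ is_lring S, is_strong_unit S, is_fring S & is_semi_low S].

Definition lu_isomorphic (S T : luRingData) : Prop :=
  exists phi : S -> T,
    [/\ bijective phi,
        [/\ phi lzero = lzero,
            {morph phi : x y / ladd x y},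
            {morph phi : x / lopp x} &
            {morph phi : x y / lmul x y}],
        [/\ forall x y, lle x y <-> lle (phi x) (phi y),
            {morph phi : x y / lmeet x y} &
            {morph phi : x y / ljoin x y}] &
        phi lunit = lunit].

(** * Products, sub-l-rings, and the ring of bounded integer functions *)

Definition prod_lring (I : Type) (S : I -> lRingData) : lRingData := {|
  lcarrier := forall i, S i;
  lzero := fun i => lzero;
  ladd := fun f g i => ladd (f i) (g i);
  lopp := fun f i => lopp (f i);
  lmul := fun f g i => lmul (f i) (g i);
  lle := fun f g => forall i, lle (f i) (g i);
  lmeet := fun f g i => lmeet (f i) (g i);
  ljoin := fun f g i => ljoin (f i) (g i)
|}.

Record is_sub_lring (S : lRingData) (B : set S) : Prop := IsSubLRing {
  sub0 : B lzero;
  subD : forall x y, B x -> B y -> B (ladd x y);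
  subN : forall x, B x -> B (lopp x);
  subM : forall x y, B x -> B y -> B (lmul x y);
  subI : forall x y, B x -> B y -> B (lmeet x y);
  subU : forall x y, B x -> B y -> B (ljoin x y)
}.

Definition sub_lring (S : lRingData) (B : set S) (hB : is_sub_lring B) :
    lRingData := {|
  lcarrier := {x : S | B x};
  lzero := exist _ lzero (sub0 hB);
  ladd := fun x y => exist _ _ (subD hB (proj2_sig x) (proj2_sig y));
  lopp := fun x => exist _ _ (subN hB (proj2_sig x));
  lmul := fun x y => exist _ _ (subM hB (proj2_sig x) (proj2_sig y));
  lle := fun x y => lle (proj1_sig x) (proj1_sig y);
  lmeet := fun x y => exist _ _ (subI hB (proj2_sig x) (proj2_sig y));
  ljoin := fun x y => exist _ _ (subU hB (proj2_sig x) (proj2_sig y))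
|}.

Definition generated (S : lRingData) (G : set S) : set S :=
  smallest (@is_sub_lring S) G.

Lemma generated_sub (S : lRingData) (G : set S) : is_sub_lring (generated G).
Proof.
split=> [|x y Bx By|x Bx|x y Bx By|x y Bx By|x y Bx By] M /= [sM GM].
- exact: sub0.
- by apply: subD => //; [exact: Bx | exact: By].
- by apply: subN => //; exact: Bx.
- by apply: subM => //; [exact: Bx | exact: By].
- by apply: subI => //; [exact: Bx | exact: By].
- by apply: subU => //; [exact: Bx | exact: By].
Qed.

Lemma generated_base (S : lRingData) (G : set S) x : G x -> generated G x.
Proof. by move=> Gx M [_]; apply. Qed.

Definition int_lring : lRingData := {|
  lcarrier := int;
  lzero := 0;
  ladd := fun m n => m + n;
  lopp := fun m => - m;
  lmul := fun m n => m * n;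
  lle := fun m n => m <= n;
  lmeet := fun m n => Num.min m n;
  ljoin := fun m n => Num.max m n
|}.

Section BoundedFunctions.
Variable X : Type.

Definition ZX : lRingData := prod_lring (fun _ : X => int_lring).

Definition bounded_int : set ZX :=
  [set f : X -> int | exists N : int, forall x, `|f x| <= N].

Lemma bounded_int_sub : is_sub_lring bounded_int.
Proof.
split=> [|f g [M hM] [N hN]|f [M hM]|f g [M hM] [N hN]|f g [M hM] [N hN]
        |f g [M hM] [N hN]] /=.
- by exists 0 => x; rewrite normr0.
- by exists (M + N) => x; rewrite (le_trans (ler_normD _ _))// lerD.
- by exists M => x; rewrite normrN.
- by exists (M * N) => x; rewrite normrM ler_pM.
- by exists (M + N) => x; have := hM x; have := hN x => /=;
    rewrite /Num.min; case: ifP; lia.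
- by exists (M + N) => x; have := hM x; have := hN x => /=;
    rewrite /Num.max; case: ifP; lia.
Qed.

Lemma bounded_int_one : bounded_int (fun=> 1).
Proof. by exists 1. Qed.

Definition bounded_int_ring : luRingData := {|
  lu_lring := sub_lring bounded_int_sub;
  lunit := exist _ _ bounded_int_one
|}.

End BoundedFunctions.

(** * The l_u-ring of a totally ordered PMV_f-algebra *)

Section ChainSharp.
Variable A : pmvfType.

Inductive chain_glue : int * A -> int * A -> Prop :=
  ChainGlue m : chain_glue (m + 1, mv0) (m, mvu).

Definition chain_eq (p q : int * A) : bool :=
  `[< clos_refl_sym_trans _ chain_glue p q >].

Lemma chain_eq_refl : reflexive chain_eq.
Proof. by move=> p; apply/asboolP; exact: rst_refl. Qed.

Lemma chain_eq_sym : symmetric chain_eq.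
Proof. by move=> p q; apply/asboolP/asboolP; exact: rst_sym. Qed.

Lemma chain_eq_trans : transitive chain_eq.
Proof.
move=> q p r /asboolP pq /asboolP qr; apply/asboolP; exact: rst_trans pq qr.
Qed.

Canonical chain_equiv :=
  EquivRel chain_eq chain_eq_refl chain_eq_sym chain_eq_trans.

Definition chain_carrier : Type := {eq_quot chain_equiv}.
HB.instance Definition _ := Choice.on chain_carrier.
HB.instance Definition _ := EqQuotient.on chain_carrier.

Definition cpair (m : int) (a : A) : chain_carrier := \pi_chain_carrier (m, a).

Lemma cpair_glue m : cpair (m + 1) mv0 = cpair m mvu.
Proof. by apply/eqmodP/asboolP/rst_step; constructor. Qed.

Definition chain_add (x y : chain_carrier) : chain_carrier :=
  let: (m, a) := repr x in
  let: (n, b) := repr y in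
  if (a ⊕ b)%mv == mvu then cpair (m + n + 1) (a ⊙ b)%mv
  else cpair (m + n) (a ⊕ b)%mv.

Definition chain_opp (x : chain_carrier) : chain_carrier :=
  let: (m, a) := repr x in cpair (- m - 1) (¬ a)%mv.

Definition chain_zmul (k : int) (x : chain_carrier) : chain_carrier :=
  match k with
  | Posz n => iter n (chain_add x) (cpair 0 mv0)
  | Negz n => chain_opp (iter n.+1 (chain_add x) (cpair 0 mv0))
  end.

Definition chain_mul (x y : chain_carrier) : chain_carrier :=
  let: (m, a) := repr x in
  let: (n, b) := repr y in
  chain_add
    (chain_add
      (chain_add (chain_zmul (m * n) (cpair 0 (mvu · mvu)%mv))
                 (chain_zmul m (cpair 0 (b · mvu)%mv)))
      (chain_zmul n (cpair 0 (a · mvu)%mv)))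
    (cpair 0 (a · b)%mv).

(* The disjunct [x = y] matters only when [A] has a single element, in which
   case no representative has a second entry different from [mvu]. *)
Definition chain_le (x y : chain_carrier) : Prop :=
  x = y \/
  exists m a n b,
    [/\ x = cpair m a, y = cpair n b, a <> mvu, b <> mvu &
        (m < n) \/ (m = n /\ mvle a b)].

Definition chain_lring : lRingData := {|
  lcarrier := chain_carrier;
  lzero := cpair 0 mv0;
  ladd := chain_add;
  lopp := chain_opp;
  lmul := chain_mul;
  lle := chain_le;
  lmeet := fun x y => if `[< chain_le x y >] then x else y;
  ljoin := fun x y => if `[< chain_le x y >] then y else x
|}.

Definition chain_sharp : luRingData :=
  {| lu_lring := chain_lring; lunit := cpair 0 mvu |}.

(* Addition and opposite do not depend on the representatives picked by
   [repr]. *)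

Lemma chain_eq_ind (T : Type) (f : int * A -> T) :
  (forall m, f (m + 1, mv0) = f (m, mvu)) ->
  forall p q, chain_eq p q -> f p = f q.
Proof.
move=> H p q /asboolP; elim=> // {p q} [p q [m] | p q r _ -> _ ->] //.
Qed.

Lemma repr_cpair m a : chain_eq (repr (cpair m a)) (m, a).
Proof. by rewrite -[chain_eq _ _]eqmodE; apply/eqP; rewrite reprK. Qed.

Lemma chain_oppE m a : chain_opp (cpair m a) = cpair (- m - 1) (¬ a)%mv.
Proof.
pose f (p : int * A) := cpair (- p.1 - 1) (¬ p.2)%mv.
have -> : chain_opp (cpair m a) = f (repr (cpair m a)).
  by rewrite /chain_opp; case: (repr _).
rewrite -/(f (m, a)); apply: chain_eq_ind (repr_cpair m a) => k.
by rewrite /f /= mvnegu -/mvu -cpair_glue; congr cpair; lia.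
Qed.

Lemma chain_addE m a n b : chain_add (cpair m a) (cpair n b) =
  if (a ⊕ b)%mv == mvu then cpair (m + n + 1) (a ⊙ b)%mv
  else cpair (m + n) (a ⊕ b)%mv.
Proof.
pose f (p q : int * A) := if (p.2 ⊕ q.2)%mv == mvu
  then cpair (p.1 + q.1 + 1) (p.2 ⊙ q.2)%mv
  else cpair (p.1 + q.1) (p.2 ⊕ q.2)%mv.
have fC p q : f p q = f q p.
  by rewrite /f (addrC p.1) (mvaddC p.2) /mvmul (mvaddC (mvneg p.2)).
have f_glue k q : f (k + 1, mv0) q = f (k, mvu) q.
  rewrite /f /= mvadd0x mvaddux eqxx /mvmul mvnegu mvadd0x -/mvu mvaddux mvnegu.
  rewrite mvnegK; case: eqP => [-> | _]; last by congr cpair; lia.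
  by rewrite -[RHS]cpair_glue; congr cpair; lia.
have -> : chain_add (cpair m a) (cpair n b)
        = f (repr (cpair m a)) (repr (cpair n b)).
  by rewrite /chain_add; case: (repr _); case: (repr _).
rewrite -/(f (m, a) (n, b)).
transitivity (f (m, a) (repr (cpair n b))).
  apply: (chain_eq_ind (f := f^~ (repr (cpair n b)))) (repr_cpair m a) => k.
  exact: f_glue.
apply: chain_eq_ind (repr_cpair n b) => k.
by rewrite fC f_glue fC.
Qed.

End ChainSharp.

(** * The l_u-ring of a PMV_f-algebra *)

Section Sharp.
Variable A : pmvfType.

Definition sharp_prod : lRingData :=
  prod_lring (fun P : Spec A => chain_lring (mvquot (proj1_sig P))).

Definition sharp_hat (a : A) : sharp_prod :=
  fun P => cpair 0 (mvclass (proj1_sig P) a).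

Definition sharp_gen : set sharp_prod := [set sharp_hat a | a in [set: A]].

Lemma sharp_gen_hat a : generated sharp_gen (sharp_hat a).
Proof. by apply: generated_base; exists a. Qed.

Definition sharp : luRingData := {|
  lu_lring := sub_lring (generated_sub sharp_gen);
  lunit := exist _ _ (sharp_gen_hat mvu)
|}.

End Sharp.

(* Main.v *)
Require Import Defs.
From mathcomp Require Import all_boot all_order all_algebra.
From mathcomp Require Import boolp classical_sets zify.

Set Implicit Arguments.
Unset Strict Implicit.
Unset Printing Implicit Defensive.

Import Order.TTheory GRing.Theory Num.Theory.
Local Open Scope ring_scope.

(** An element of [2^X] or its complement lies in each prime ideal [P], so the
    chain [2^X / P] has no elements but its bounds: it is the two-element chain, or
    the one-element one if [P] is improper. Correspondingly [(2^X / P)^sharp] is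
    the ring of integers, or the zero ring, and every element of it is the image of
    some integer [k] under [chain_int].

    A bounded function [f : X -> int] takes some value [k] outside of a set of [P],
    and this is its limit along the ultrafilter dual to [P]. The relation [limit g f]
    says that [g] lists the limits of [f] along all prime ideals. It is compatible
    with all the operations, and it is the graph of the isomorphism:
    - [f] is determined by [g] ([limit_inj]), since the limit along the principal
      prime ideal at [x] is [f x];
    - [g] is determined by [f] and the orders correspond ([limit_unique],
      [limit_le]), since finitely many limits along a proper [P] are attained
      simultaneously at a point ([limit_attained]);
    - every [g] in the generated sub-l-ring is the limit of some bounded [f]
      ([sharp_limit]), because the generator of [a] is the limit of the indicator
      function of [a], and bounded functions are closed under the operations;
    - every bounded [f] has a limit in the generated sub-l-ring
      ([bounded_limit]), because up to a constant it is a finite sum of indicator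
      functions.
    The laws of a semi-low f_u-ring then hold in [(2^X)^sharp] because they hold
    pointwise for integer functions. *)

(** * Transfer of l-ring laws along embeddings *)

Record lring_embedding (S T : lRingData) (phi : S -> T) : Prop := LRingEmbedding {
  emb_inj : injective phi;
  emb0 : phi lzero = lzero;
  embD : {morph phi : x y / ladd x y};
  embN : {morph phi : x / lopp x};
  embM : {morph phi : x y / lmul x y};
  emb_le : forall x y, lle x y <-> lle (phi x) (phi y);
  embI : {morph phi : x y / lmeet x y};
  embU : {morph phi : x y / ljoin x y}
}.

Section Embedding.
Variables (S T : lRingData) (phi : S -> T).
Hypothesis emb : lring_embedding phi.

Let inj := emb_inj emb.
Let phiE := (embD emb, embN emb, embM emb, embI emb, embU emb, emb0 emb).

Lemma lring_of_embedding : is_lring T -> is_lring S.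
Proof.
move=> hT; split.
- by move=> x y z; apply: inj; rewrite !phiE (laddA hT).
- by move=> x y; apply: inj; rewrite !phiE (laddC hT).
- by move=> x; apply: inj; rewrite !phiE (ladd0 hT).
- by move=> x; apply: inj; rewrite !phiE (laddN hT).
- by move=> x y z; apply: inj; rewrite !phiE (lmulA hT).
- by move=> x y; apply: inj; rewrite !phiE (lmulC hT).
- by move=> x y z; apply: inj; rewrite !phiE (lmulDl hT).
- by move=> x; apply/(emb_le emb); exact: (lle_refl hT).
- by move=> x y /(emb_le emb) xy /(emb_le emb) yx; apply: inj; exact: (lle_anti hT).
- move=> y x z /(emb_le emb) xy /(emb_le emb) yz; apply/(emb_le emb).
  exact: (lle_trans hT) xy yz.
- by move=> x y z; rewrite !(emb_le emb) phiE; exact: (lmeet_glb hT).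
- by move=> x y z; rewrite !(emb_le emb) phiE; exact: (ljoin_lub hT).
- by move=> x y z /(emb_le emb) xy; apply/(emb_le emb); rewrite !phiE; exact: (lle_add hT).
- by move=> x y; rewrite !(emb_le emb) !phiE; exact: (lmul_ge0 hT).
Qed.

Lemma fring_of_embedding : is_fring T -> is_fring S.
Proof.
move=> hT a b c /(congr1 phi) + /(emb_le emb); rewrite !phiE => ab c0.
by have [h1 h2] := hT _ _ _ ab c0; split; apply: inj; rewrite !phiE.
Qed.

Lemma emb_natmul n x : phi (lnatmul n x) = lnatmul n (phi x).
Proof.
elim: n => [|n IHn]; first exact: emb0.
by rewrite /lnatmul /= -!/(lnatmul n _) phiE IHn.
Qed.

End Embedding.

(** All the laws are universal except for the existence of a bound [n] in the strong
    unit axiom, and that [n] is the same on both sides. *)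
Lemma semi_low_fu_of_embedding (S T : luRingData) (phi : S -> T) :
  lring_embedding phi -> phi lunit = lunit ->
  is_semi_low_fu_ring T -> is_semi_low_fu_ring S.
Proof.
move=> emb phiu [lT [u0 uT] fT sT]; have le := emb_le emb.
split; [exact: lring_of_embedding emb lT | split | exact: fring_of_embedding emb fT |].
- by rewrite le (emb0 emb) phiu.
- move=> x; have [n xn] := uT (phi x); exists n.
  by rewrite le (emb_natmul emb) phiu /labs (embU emb) (embN emb).
- move=> a b; rewrite !le (embM emb) (embI emb) (emb0 emb) phiu => a0 a1 b0 b1.
  exact: sT.
Qed.

Lemma sub_lring_embedding (S : lRingData) (B : set S) (hB : is_sub_lring B) :
  lring_embedding (fun x : sub_lring hB => proj1_sig x).
Proof. by split=> // -[x hx] [y hy] /= xy; exact: eq_exist. Qed.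

(** * Bounded integer functions *)

Lemma int_is_lring : is_lring int_lring.
Proof.
split=> /=.
- exact: addrA.
- exact: addrC.
- exact: add0r.
- exact: addNr.
- exact: mulrA.
- exact: mulrC.
- exact: mulrDl.
- by [].
- by move=> x y xy yx; apply/eqP; rewrite eq_le xy.
- by move=> y x z; exact: le_trans.
- by move=> x y z; rewrite le_min; split=> /andP.
- by move=> x y z; rewrite ge_max; split=> /andP.
- by move=> x y z xy; rewrite lerD2r.
- by move=> x y; exact: mulr_ge0.
Qed.

Lemma int_is_fring : is_fring int_lring.
Proof.
move=> a b c /= ab c0.
have [a0 b0] : 0 <= a /\ 0 <= b by apply/andP; rewrite -le_min ab.
split; have := ab; rewrite /Num.min; case: ltP => // _ ->;
  by rewrite ?mul0r ?mulr0; case: ltP => //; nia.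
Qed.

Section Product.
Variables (I : Type) (S : I -> lRingData).

Lemma prod_is_lring : (forall i, is_lring (S i)) -> is_lring (prod_lring S).
Proof.
move=> hS; split=> /=.
- by move=> x y z; apply/functional_extensionality_dep => i; exact: (laddA (hS i)).
- by move=> x y; apply/functional_extensionality_dep => i; exact: (laddC (hS i)).
- by move=> x; apply/functional_extensionality_dep => i; exact: (ladd0 (hS i)).
- by move=> x; apply/functional_extensionality_dep => i; exact: (laddN (hS i)).
- by move=> x y z; apply/functional_extensionality_dep => i; exact: (lmulA (hS i)).
- by move=> x y; apply/functional_extensionality_dep => i; exact: (lmulC (hS i)).
- by move=> x y z; apply/functional_extensionality_dep => i; exact: (lmulDl (hS i)).
- by move=> x i; exact: (lle_refl (hS i)).
- by move=> x y xy yx; apply/functional_extensionality_dep => i; exact: (lle_anti (hS i)).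
- by move=> y x z xy yz i; exact: (lle_trans (hS i)) (xy i) (yz i).
- move=> x y z; split=> [h | [h1 h2] i]; last by apply/(lmeet_glb (hS i)).
  by split=> i; have /(lmeet_glb (hS i))[] := h i.
- move=> x y z; split=> [h | [h1 h2] i]; last by apply/(ljoin_lub (hS i)).
  by split=> i; have /(ljoin_lub (hS i))[] := h i.
- by move=> x y z xy i; exact: (lle_add (hS i)).
- by move=> x y x0 y0 i; exact: (lmul_ge0 (hS i)).
Qed.

Lemma prod_is_fring : (forall i, is_fring (S i)) -> is_fring (prod_lring S).
Proof.
move=> hS a b c /= ab c0.
have h i := hS i _ _ _ (congr1 (@^~ i) ab) (c0 i).
by split; apply/functional_extensionality_dep => i; case: (h i).
Qed.

End Product.

Lemma lnatmul_bounded1 (X : Type) n x :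
  proj1_sig (lnatmul n (lunit : bounded_int_ring X)) x = n%:Z.
Proof.
elim: n => [|n IHn] //.
by rewrite /lnatmul /= -/(lnatmul n _) IHn; lia.
Qed.

Lemma bounded_semi_low_fu (X : Type) : is_semi_low_fu_ring (bounded_int_ring X).
Proof.
have emb := sub_lring_embedding (@bounded_int_sub X).
split; [ | split | |].
- by apply: lring_of_embedding emb _; apply: prod_is_lring => _; exact: int_is_lring.
- by [].
- move=> [f [N hN]]; exists `|N|%N => x; rewrite lnatmul_bounded1 /=.
  by rewrite ge_max; have := hN x; lia.
- by apply: fring_of_embedding emb _; apply: prod_is_fring => _; exact: int_is_fring.
- move=> [f hf] [g hg] /= f0 f1 g0 g1 x.
  have := f0 x; have := f1 x; have := g0 x; have := g1 x; rewrite /= le_min.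
  by nia.
Qed.

(** * Integers in a chain *)

(** The integer multiples of the unit; they exhaust [chain_carrier A] as soon as
    [A] has no element besides its bounds. *)
Definition chain_int (A : pmvfType) (k : int) : chain_carrier A := cpair k mv0.

Section ChainInt.
Variable A : pmvfType.
Local Notation cint := (@chain_int A).
Hypothesis two_valued : forall a : A, a = mv0 \/ a = mvu.
Hypothesis mvu_idem : pmul mvu mvu = mvu :> A.

(** The gluing of [(m + 1, 0)] with [(m, u)] identifies all consecutive integers
    when [0 = u]. *)
Lemma chain_collapse (x y : chain_carrier A) : mv0 = mvu :> A -> x = y.
Proof.
move=> A1; suff cint_eq0 k : cint k = cint 0.
  have all0 z : z = cint 0.
    rewrite -[z]reprK; case: (repr z) => m a.
    have -> : a = mv0 by case: (two_valued a); rewrite -?A1.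
    exact: cint_eq0.
  by rewrite (all0 x) (all0 y).
have step m : cint (m + 1) = cint m by rewrite /chain_int cpair_glue A1.
elim/int_rect: k => // n IHn; rewrite -IHn; last rewrite -[LHS]step.
  by rewrite -[RHS]step; congr cint; lia.
by congr cint; lia.
Qed.

Lemma chain_int_inj : mv0 <> mvu :> A -> injective cint.
Proof.
move=> A2 k l kl.
(* [val] is constant on glued pairs, so it is a left inverse of [cint]. *)
pose val (p : int * A) := if p.2 == mvu then p.1 + 1 else p.1.
have val_glue m : val (m + 1, mv0) = val (m, mvu).
  by rewrite /val /= eqxx; case: eqP.
have val_cint m : val (repr (cint m)) = m.
  by rewrite (chain_eq_ind val_glue (repr_cpair m mv0)) /val /=; case: eqP.
by rewrite -(val_cint k) kl val_cint.
Qed.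

Lemma chain_intD m n : chain_add (cint m) (cint n) = cint (m + n).
Proof.
have [A1 | A2] := eqVneq (mv0 : A) mvu; first exact: chain_collapse.
by rewrite chain_addE mvaddx0 (negPf A2).
Qed.

Lemma chain_intN m : chain_opp (cint m) = cint (- m).
Proof.
by rewrite chain_oppE -[mvneg mv0]/mvu -cpair_glue /chain_int; congr cpair; lia.
Qed.

Lemma chain_int_zmul k l : chain_zmul k (cint l) = cint (k * l).
Proof.
have nat_case n : iter n (chain_add (cint l)) (cint 0) = cint (n%:Z * l).
  elim: n => [|n IHn]; first by congr cint; lia.
  by rewrite iterS IHn chain_intD; congr cint; lia.
case: k => n; rewrite /chain_zmul -/(cint 0) nat_case //.
by rewrite chain_intN; congr cint; lia.
Qed.

Definition bound (b : bool) : A := if b then mvu else mv0.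

Lemma cpair_bound m b : cpair m (bound b) = cint (m + b%:Z).
Proof. by case: b; rewrite /= ?addr0 // /chain_int -cpair_glue. Qed.

Lemma pmul_bound b c : pmul (bound b) (bound c) = bound (b && c).
Proof. by case: b; case: c; rewrite /= ?pmulx0 // pmulC pmulx0. Qed.

(** The product is defined on the representatives chosen by [repr], and if [0] and
    [u] are distinct, that of [cint k] may be [(k, 0)] as well as [(k - 1, u)]; the
    bit [b] tells which. *)
Lemma chain_intP (x : chain_carrier A) :
  exists m b, repr x = (m, bound b) /\ x = cint (m + b%:Z).
Proof.
case E: (repr x) => [m a].
have [b ab] : exists b, a = bound b.
  by case: (two_valued a) => ->; [exists false | exists true].
by exists m, b; rewrite -cpair_bound -ab /cpair -E reprK.
Qed.

(** On the representatives [(m, b)] and [(n, c)], where [b] and [c] are bits, the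
    defining formula reads [mn + mc + nb + bc = (m + b)(n + c)]. *)
Lemma chain_intM m n : chain_mul (cint m) (cint n) = cint (m * n).
Proof.
have [A1 | /eqP A2] := eqVneq (mv0 : A) mvu; first exact: chain_collapse.
have [m' [b [Em]]] := chain_intP (cint m).
have [n' [c [En]]] := chain_intP (cint n).
move=> /(chain_int_inj A2) n_eq /(chain_int_inj A2) m_eq.
rewrite /chain_mul Em En -[mvu]/(bound true) !pmul_bound !cpair_bound.
rewrite !chain_int_zmul !chain_intD m_eq n_eq; congr cint.
by case: b {Em m_eq}; case: c {En n_eq} => /=; lia.
Qed.

Lemma chain_int_le m n : mv0 <> mvu :> A ->
  chain_le (cint m) (cint n) <-> m <= n.
Proof.
move=> A2; split=> [[/(chain_int_inj A2) -> // | [m' [a [n' [b []]]]]] | ].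
  case: (two_valued a) => -> //; case: (two_valued b) => -> //.
  by move=> /(chain_int_inj A2) -> /(chain_int_inj A2) -> _ _ [|[-> _]]; lia.
rewrite le_eqVlt => /orP[/eqP -> | mn]; [by left | right].
by exists m, mv0, n, mv0; split=> //; left.
Qed.

Lemma chain_intI m n :
  lmeet (cint m : chain_lring A) (cint n) = cint (Num.min m n).
Proof.
have [A1 | /eqP A2] := eqVneq (mv0 : A) mvu; first exact: chain_collapse.
rewrite /=; case: asboolP => /(chain_int_le _ _ A2) => [|/negP]; last rewrite -ltNge.
  by move=> /min_idPl ->.
by move=> /ltW/min_idPr ->.
Qed.

Lemma chain_intU m n :
  ljoin (cint m : chain_lring A) (cint n) = cint (Num.max m n).
Proof.
have [A1 | /eqP A2] := eqVneq (mv0 : A) mvu; first exact: chain_collapse.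
rewrite /=; case: asboolP => /(chain_int_le _ _ A2) => [|/negP]; last rewrite -ltNge.
  by move=> /max_idPr ->.
by move=> /ltW/max_idPl ->.
Qed.

End ChainInt.

(** * Limits of integer functions along prime ideals of [2^X] *)

Section Limit.
Variable X : Type.
Implicit Types (P : Spec (pow2 X)) (f : ZX X) (g : sharp_prod (pow2 X)).

Local Notation chain P := (mvquot (proj1_sig P)).
Local Notation mem P a := (ideal_set (proj1_sig P) a).

Lemma pow2_meetE (a b : pow2 X) : mvmeet a b = (fun x => a x && b x).
Proof.
apply/funext => x; rewrite /mvmeet /mvjoin /mvsub /mvneg /mvadd /=.
by case: (a x); case: (b x).
Qed.

Lemma pow2_le (a b : pow2 X) : mvle a b <-> forall x, a x -> b x.
Proof.
split=> [/(congr1 (fun c : pow2 X => c _)) ab x | ab].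
  by move: (ab x); rewrite /mvsub /mvneg /mvadd /mv0 /=; case: (a x); case: (b x).
apply/funext => x; move: (ab x); rewrite /mvsub /mvneg /mvadd /mv0 /=.
by case: (a x); case: (b x) => // /(_ isT).
Qed.

Lemma prime_mem_or P (a : pow2 X) : mem P a \/ mem P (mvneg a).
Proof.
case: P => P primeP /=; apply: primeP.
suff -> : mvmeet a (mvneg a) = mv0 by exact: ideal0.
by rewrite pow2_meetE; apply/funext => x; exact: andbN.
Qed.

Lemma mvclass0 P (a : pow2 X) : mem P a -> mvclass (proj1_sig P) a = mv0.
Proof.
move=> aP; apply/mvclassP; split; apply: ideal_down aP; first exact: mvle_subl.
by apply/pow2_le => x; rewrite /mvsub /mvneg /mvadd /=.
Qed.

Lemma mvclassu P (a : pow2 X) : mem P (mvneg a) -> mvclass (proj1_sig P) a = mvu.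
Proof.
by move=> /mvclass0 naP; rewrite -[a]mvnegK -mvclassN naP.
Qed.

Lemma quot_two_valued P (c : chain P) : c = mv0 \/ c = mvu.
Proof.
rewrite (mvclass_repr c).
by case: (prime_mem_or P (repr c)) => [/mvclass0 | /mvclassu]; [left | right].
Qed.

Lemma quot_mvu_idem P : pmul mvu mvu = mvu :> chain P.
Proof.
have -> : mvu = mvclass (proj1_sig P) mvu by rewrite /mvu -mvclassN.
by rewrite -[LHS]/(quot_mul _ _) quot_mulE; congr mvclass; apply/funext.
Qed.

Lemma quot_trivial P : mem P mvu <-> mv0 = mvu :> chain P.
Proof.
split=> [uP | P1]; first by rewrite -(mvclass0 uP) /mvu -mvclassN.
have : mvclass (proj1_sig P) mvu = mvclass (proj1_sig P) mv0.
  by rewrite /mvu -mvclassN -[LHS]P1.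
by move=> /mvclassP[+ _]; rewrite /mvsub mvnegu !mvadd0x.
Qed.

Definition principal_ideal (x : X) : ideal (pow2 X).
Proof.
refine (@Ideal (pow2 X) (fun a => a x = false) _ _ _).
- by exists mv0.
- by move=> a b /pow2_le /(_ x); case: (a x) => // /(_ isT) ->.
- by move=> a b /= ax bx; rewrite /mvadd /= ax bx.
Defined.

Lemma principal_prime x : is_prime (principal_ideal x).
Proof. by move=> a b /=; rewrite pow2_meetE; case: (a x); [right | left]. Qed.

Definition principal (x : X) : Spec (pow2 X) := exist _ _ (@principal_prime x).

(** Membership of this set in [P] expresses that [k] is a limit of [f] along [P]. *)
Definition neq_set f (k : int) : pow2 X := fun x => f x != k.

Definition limit g f : Prop :=
  forall P, exists k, g P = chain_int _ k /\ mem P (neq_set f k).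

(** Where [f1] and [f2] both take their limit values, so does [op f1 f2]: its
    exceptional set is below the join of theirs. *)
Lemma limit_op2 (op : int -> int -> int)
    (opP : forall P, chain_carrier (chain P) -> chain_carrier (chain P) ->
                     chain_carrier (chain P)) g1 f1 g2 f2 :
  (forall P m n, opP P (chain_int _ m) (chain_int _ n) = chain_int _ (op m n)) ->
  limit g1 f1 -> limit g2 f2 ->
  limit (fun P => opP P (g1 P) (g2 P)) (fun x => op (f1 x) (f2 x)).
Proof.
move=> opPE lim1 lim2 P; have [k1 [-> P1]] := lim1 P; have [k2 [-> P2]] := lim2 P.
exists (op k1 k2); split; first exact: opPE.
apply: ideal_down (ideal_add P1 P2).
apply/pow2_le => x; rewrite /neq_set /mvadd /= -negb_and.
by apply: contra => /andP[/eqP -> /eqP ->].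
Qed.

Lemma limit_hat (a : pow2 X) : limit (sharp_hat a) (fun x => (a x)%:Z).
Proof.
move=> P; case: (prime_mem_or P a) => aP.
  exists 0; rewrite /sharp_hat (mvclass0 aP); split=> //; apply: ideal_down aP.
  by apply/pow2_le => x; rewrite /neq_set; case: (a x).
exists 1; rewrite /sharp_hat (mvclassu aP) -cpair_glue; split=> //.
apply: ideal_down aP.
by apply/pow2_le => x; rewrite /neq_set /mvneg /=; case: (a x).
Qed.

Lemma limit0 : limit lzero (fun=> 0).
Proof. by move=> P; exists 0; split=> //; exact: ideal0. Qed.

Lemma limitD g1 f1 g2 f2 :
  limit g1 f1 -> limit g2 f2 -> limit (ladd g1 g2) (ladd f1 f2).
Proof.
apply: (limit_op2 (opP := fun P => @ladd (chain_lring (chain P)))) => P m n.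
exact/chain_intD/quot_two_valued.
Qed.

Lemma limitN g f : limit g f -> limit (lopp g) (lopp f).
Proof.
move=> lim P; have [k [gP fP]] := lim P; exists (- k).
rewrite /= gP chain_intN; split=> //; apply: ideal_down fP.
by apply/pow2_le => x; rewrite /neq_set /= eqr_opp.
Qed.

Lemma limitM g1 f1 g2 f2 :
  limit g1 f1 -> limit g2 f2 -> limit (lmul g1 g2) (lmul f1 f2).
Proof.
apply: (limit_op2 (opP := fun P => @lmul (chain_lring (chain P)))) => P m n.
by apply: chain_intM; [exact: quot_two_valued | exact: quot_mvu_idem].
Qed.

Lemma limitI g1 f1 g2 f2 :
  limit g1 f1 -> limit g2 f2 -> limit (lmeet g1 g2) (lmeet f1 f2).
Proof.
apply: (limit_op2 (opP := fun P => @lmeet (chain_lring (chain P)))) => P m n.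
exact/chain_intI/quot_two_valued.
Qed.

Lemma limitU g1 f1 g2 f2 :
  limit g1 f1 -> limit g2 f2 -> limit (ljoin g1 g2) (ljoin f1 f2).
Proof.
apply: (limit_op2 (opP := fun P => @ljoin (chain_lring (chain P)))) => P m n.
exact/chain_intU/quot_two_valued.
Qed.

(** The exceptional sets of [f1] and [f2] cannot cover [X], as the ideal [P] is
    proper. *)
Lemma limit_attained g1 f1 g2 f2 P : limit g1 f1 -> limit g2 f2 ->
  mv0 <> mvu :> chain P ->
  exists x, g1 P = chain_int _ (f1 x) /\ g2 P = chain_int _ (f2 x).
Proof.
move=> /(_ P)[k1 [-> P1]] /(_ P)[k2 [-> P2]] /quot_trivial properP.
apply: contrapT => no_x; apply: properP; apply: ideal_down (ideal_add P1 P2).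
apply/pow2_le => x _; rewrite /neq_set /mvadd /= -negb_and.
by apply/negP => /andP[/eqP f1x /eqP f2x]; apply: no_x; exists x; rewrite f1x f2x.
Qed.

Lemma principal_nontrivial x : mv0 <> mvu :> chain (principal x).
Proof. by move=> /quot_trivial. Qed.

Lemma limit_principal g f x : limit g f -> g (principal x) = chain_int _ (f x).
Proof. by move=> /(_ (principal x))[k [-> /negbFE/eqP ->]]. Qed.

Lemma limit_inj g f1 f2 : limit g f1 -> limit g f2 -> f1 = f2.
Proof.
move=> lim1 lim2; apply/functional_extensionality_dep => x.
apply: (chain_int_inj (@principal_nontrivial x)).
by rewrite -(limit_principal x lim1) (limit_principal x lim2).
Qed.

Lemma limit_unique g1 g2 f : limit g1 f -> limit g2 f -> g1 = g2.
Proof.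
move=> lim1 lim2; apply/functional_extensionality_dep => P.
have [P1 | /eqP P2] := eqVneq (mv0 : chain P) mvu.
  exact: chain_collapse (@quot_two_valued P) _ _ P1.
by have [x [-> ->]] := limit_attained lim1 lim2 P2.
Qed.

Lemma limit_le g1 f1 g2 f2 : limit g1 f1 -> limit g2 f2 ->
  lle g1 g2 <-> lle f1 f2.
Proof.
move=> lim1 lim2; split=> [g12 x | f12 P].
  have := g12 (principal x).
  rewrite (limit_principal x lim1) (limit_principal x lim2).
  move=> /chain_int_le; apply; first exact: quot_two_valued.
  exact: principal_nontrivial.
have [P1 | /eqP P2] := eqVneq (mv0 : chain P) mvu.
  by left; exact: chain_collapse (@quot_two_valued P) _ _ P1.
have [x [-> ->]] := limit_attained lim1 lim2 P2.
by apply/chain_int_le; [exact: quot_two_valued | exact: P2 | exact: f12].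
Qed.

Lemma limits_sub_lring :
  is_sub_lring [set g | exists2 f : ZX X, bounded_int f & limit g f]%classic.
Proof.
have bsub := @bounded_int_sub X; split=> [|g g'|g|g g'|g g'|g g'].
- by exists lzero; [exact: (sub0 bsub) | exact: limit0].
- move=> [f bf l] [f' bf' l']; exists (ladd f f'); last exact: limitD.
  exact: (subD bsub).
- move=> [f bf l]; exists (lopp f); last exact: limitN.
  exact: (subN bsub).
- move=> [f bf l] [f' bf' l']; exists (lmul f f'); last exact: limitM.
  exact: (subM bsub).
- move=> [f bf l] [f' bf' l']; exists (lmeet f f'); last exact: limitI.
  exact: (subI bsub).
- move=> [f bf l] [f' bf' l']; exists (ljoin f f'); last exact: limitU.
  exact: (subU bsub).
Qed.

Lemma sharp_limit (s : sharp (pow2 X)) :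
  exists t : bounded_int_ring X, limit (proj1_sig s) (proj1_sig t).
Proof.
case: s => g gen_g.
have [|f bf lim] := gen_g [set g | exists2 f : ZX X, bounded_int f & limit g f]%classic.
  split; first exact: limits_sub_lring.
  move=> _ [a _ <-]; exists (fun x => (a x)%:Z); last exact: limit_hat.
  by exists 1 => x; case: (a x).
by exists (exist _ f bf).
Qed.

(** Layer by layer: subtracting from [f] the indicator of its support lowers the
    bound by one. *)
Lemma nat_valued_limit (n : nat) f : (forall x, 0 <= f x <= n%:Z) ->
  exists2 g, generated (@sharp_gen (pow2 X)) g & limit g f.
Proof.
have gsub := generated_sub (@sharp_gen (pow2 X)).
elim: n f => [|n IHn] f fn.
  exists lzero; first exact: (sub0 gsub).
  have -> : f = (fun=> 0) by apply/funext => x; have := fn x; lia.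
  exact: limit0.
pose a : pow2 X := fun x => 1 <= f x.
have [x|g gen_g lim] := IHn (fun x => f x - (a x)%:Z).
  by have := fn x; rewrite /a; case: leP => /=; lia.
exists (ladd (sharp_hat a) g).
  by apply: (subD gsub) => //; exact: sharp_gen_hat.
have -> : f = ladd ((fun x => (a x)%:Z) : ZX X) (fun x => f x - (a x)%:Z).
  by apply/funext => x /=; lia.
by apply: limitD => //; exact: limit_hat.
Qed.

(** [f] is the difference of the functions [f + M] and [M], which both have natural
    values. *)
Lemma bounded_limit (t : bounded_int_ring X) :
  exists s : sharp (pow2 X), limit (proj1_sig s) (proj1_sig t).
Proof.
have gsub := generated_sub (@sharp_gen (pow2 X)).
case: t => f [N fN]; pose M := `|N|%N.
have [x|g1 gen1 lim1] := @nat_valued_limit (M + M) (fun x => f x + M%:Z).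
  by have := fN x; lia.
have [x|g2 gen2 lim2] := @nat_valued_limit M (fun=> M%:Z); first by lia.
have gen := subD gsub gen1 (subN gsub gen2).
exists (exist _ _ gen) => /=.
have -> : f = ladd ((fun x => f x + M%:Z) : ZX X) (lopp ((fun=> M%:Z) : ZX X)).
  by apply/funext => x /=; lia.
by apply: limitD => //; exact: limitN.
Qed.

End Limit.

Lemma sharp_pow2_iso (X : Type) :
  exists phi : sharp (pow2 X) -> bounded_int_ring X,
    [/\ lring_embedding phi, bijective phi & phi lunit = lunit].
Proof.
pose phi s := projT1 (cid (@sharp_limit X s)).
pose psi t := projT1 (cid (@bounded_limit X t)).
have lim s : limit (proj1_sig s) (proj1_sig (phi s)) := projT2 (cid (sharp_limit s)).
have lim' t : limit (proj1_sig (psi t)) (proj1_sig t) := projT2 (cid (bounded_limit t)).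
have phi_eq s t : limit (proj1_sig s) (proj1_sig t) -> phi s = t.
  move=> l; apply: (emb_inj (sub_lring_embedding (@bounded_int_sub X))).
  exact: limit_inj (lim s) l.
have psiK : cancel psi phi by move=> t; apply: phi_eq; exact: lim'.
have inj : injective phi.
  move=> s s' ss'.
  apply: (emb_inj (sub_lring_embedding (generated_sub (@sharp_gen (pow2 X))))).
  by apply: limit_unique (lim s) _; rewrite ss'.
exists phi; split.
- split=> //.
  + by apply: phi_eq; exact: limit0.
  + by move=> s s'; apply: phi_eq; exact: limitD.
  + by move=> s; apply: phi_eq; exact: limitN.
  + by move=> s s'; apply: phi_eq; exact: limitM.
  + by move=> s s'; exact: limit_le.
  + by move=> s s'; apply: phi_eq; exact: limitI.
  + by move=> s s'; apply: phi_eq; exact: limitU.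
- by exists psi => // s; apply: inj; exact: psiK.
- by apply: phi_eq; exact: limit_hat.
Qed.

Theorem mainTheorem5 (X : Type) :
  is_semi_low_fu_ring (sharp (pow2 X)) /\
  lu_isomorphic (sharp (pow2 X)) (bounded_int_ring X).
Proof.
have [phi [emb phi_bij phiu]] := sharp_pow2_iso X; split.
  exact: semi_low_fu_of_embedding emb phiu (bounded_semi_low_fu X).
by exists phi; case: emb => *; split.
Qed.
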